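(* Let $\mathcal{M} = \langle \mathcal{F}, ev \rangle$ be a Veltman model with $\mathcal{F} = \langle W, R, \{S_w \mid w \in W\} \rangle$, and let $\mathcal{M}^{\mathrm{ue}}$ be its ultrafilter extension. For any formula $\varphi$, any $x \in W$, and any $\langle \Pi_x, \sigma \rangle \in W^{\mathrm{ue}}$ (where $\Pi_x = \{A \subseteq W \mid x \in A\}$ is the principal ultrafilter generated by $x$), we have $$\mathcal{M}, x \Vdash \varphi \iff \mathcal{M}^{\mathrm{ue}}, \langle \Pi_x, \sigma \rangle \Vdash \varphi.$$
   Context: A Veltman frame $\langle W, R, \{S_w\}_{w\in W}\rangle$ has $R$ transitive and upwardly well-founded on a nonempty set $W$, and each $S_w$ is a reflexive, transitive relation on $R[w]=\{v\mid wRv\}$ containing $R\cap R[w]^2$; a Veltman model adds a valuation $ev:\mathrm{Atm}\to\wp(W)$, with $w\Vdash \alpha\triangleright\beta$ iff for all $u$ with $wRu$ and $u\Vdash\alpha$ there is $v$ with $uS_wv$ and $v\Vdash\beta$, and $w \Vdash \Box\alpha$ iff $v\Vdash\alpha$ for all $v$ with $wRv$. $U(W)$ is the set of ultrafilters on $W$; $\overline{A}=W\setminus A$; $\widehat{R^{-1}}(Y)=\{x \mid \forall y (xRy \to y\in Y)\}$; $S^{-1}(X,Y)=\{w\in W \mid \forall x\in X (wRx \to \exists y\in Y\, xS_wy)\}$. For $l\subseteq \wp(W)\setminus\{\emptyset\}$ with the finite intersection property and $f,g\in U(W)$: $f\prec_l g$ iff for all $A\subseteq W$ and all finitely many $S_1,\dots,S_n\in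 l$, if $S^{-1}(\overline{A},\bigcup_i \overline{S_i})\in f$ then $A\in g$ and $\widehat{R^{-1}}(A)\in g$. The ultrafilter extension $\mathcal{M}^{\mathrm{ue}}=\langle W^{\mathrm{ue}},R^{\mathrm{ue}},\{S^{\mathrm{ue}}_{\langle f,\sigma\rangle}\},ev^{\mathrm{ue}}\rangle$ is defined by: $W^{\mathrm{ue}}$ is the least set containing $(f,\langle\rangle)$ for every $f\in U(W)$ and containing $(g,\sigma\frown\langle l\rangle)$ whenever $(f,\sigma)\in W^{\mathrm{ue}}$ and $f\prec_l g$; $R^{\mathrm{ue}}$ is the transitive closure of the relation $\langle f,\sigma\rangle R^{\mathrm{ue}}_{\mathrm{one}}\langle g,\sigma\frown\langle l\rangle\rangle \iff f\prec_l g$; $S^{\mathrm{ue}}_{\langle f,\sigma\rangle}$ is the smallest reflexive, transitive relation containing $R^{\mathrm{ue}}[\langle f,\sigma\rangle]^2\cap R^{\mathrm{ue}}$ and the relation holding between $\langle g,\tau\rangle$ and $\langle h,\tau'\rangle$ whenever both are $R^{\mathrm{ue}}$-successors of $\langle f,\sigma\rangle$ and $(\tau)_{|\sigma|}=(\tau')_{|\sigma|}$ (they share the same label at position $|\sigma|$); and $f\in ev^{\mathrm{ue}}(p)$ iff $ev(p)\in f$. The proof shows more generally that $\mathcal{M}^{\mathrm{ue}},\langle f,\sigma\rangle\Vdash\psi$ iff $\{w\in W\mid \mathcal{M},w\Vdash\psi\}\in f$ for every $\langle f,\sigma\rangle\in W^{\mathrm{ue}}$. *)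

(* Defs.v *)
From Stdlib Require Import Relation_Operators.
From HB Require Import structures.
From mathcomp Require Import all_boot all_classical.

Set Implicit Arguments.
Unset Strict Implicit.
Unset Printing Implicit Defensive.

Local Open Scope classical_set_scope.

(* The remaining Boolean connectives and the diamond are the usual
   abbreviations. *)
Inductive formula (Atm : Type) : Type :=
| Atom of Atm
| Bot
| Imp of formula Atm & formula Atm
| Box of formula Atm
| Rhd of formula Atm & formula Atm.

Arguments Bot {Atm}.

(* No frame condition is built in: the ultrafilter extension of a Veltman frame
   need not be upwardly well-founded, and forcing is evaluated in it too. *)
Record iframe := IFrame {
  world :> Type;
  acc : world -> world -> Prop;
  sacc : world -> world -> world -> Prop
}.

Record veltman_frame (F : iframe) : Prop := VeltmanFrame {
  world_nonempty : exists w : F, True;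
  acc_trans : forall u v w : F, acc u v -> acc v w -> acc u w;
  acc_upwf : well_founded (fun u v : F => acc v u);
  sacc_dom : forall w u v : F, sacc w u v -> acc w u /\ acc w v;
  sacc_refl : forall w u : F, acc w u -> sacc w u u;
  sacc_trans : forall w u v z : F, sacc w u v -> sacc w v z -> sacc w u z;
  sacc_acc : forall w u v : F, acc w u -> acc w v -> acc u v -> sacc w u v
}.

Fixpoint forces (Atm : Type) (F : iframe) (ev : Atm -> set F) (w : F)
    (phi : formula Atm) : Prop :=
  match phi with
  | Atom p => ev p w
  | Bot => False
  | Imp a b => forces ev w a -> forces ev w b
  | Box a => forall v, acc w v -> forces ev v a
  | Rhd a b => forall u, acc w u -> forces ev u a ->
                 exists v, sacc w u v /\ forces ev v b
  end.

Section UltrafilterExtension.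
Variable F : iframe.
Implicit Types (f g l : set_system F) (s : seq (set_system F)).

Definition box_inv (Y : set F) : set F :=
  [set x | forall y, acc x y -> Y y].

Definition rhd_inv (X Y : set F) : set F :=
  [set w | forall x, X x -> acc w x -> exists2 y, Y y & sacc w x y].

Definition label l : Prop := l `<=` [set A | A <> set0] /\ finI l id.

(* The family D may be empty; in that case the premise reads
   [f (box_inv A)]. *)
Definition prec l f g : Prop :=
  forall (A : set F) (D : set (set F)), finite_set D -> D `<=` l ->
    f (rhd_inv (~` A) (\bigcup_(X in D) ~` X)) -> g A /\ g (box_inv A).

Inductive ue_mem : set_system F -> seq (set_system F) -> Prop :=
| ue_nil f : UltraFilter f -> ue_mem f [::]
| ue_rcons f s g l : ue_mem f s -> UltraFilter g -> label l -> prec l f g ->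
    ue_mem g (rcons s l).

Definition ue_world : Type :=
  {p : set_system F * seq (set_system F) | ue_mem p.1 p.2}.

Definition ue_filter (w : ue_world) : set_system F := (sval w).1.
Definition ue_seq (w : ue_world) : seq (set_system F) := (sval w).2.

Definition ue_acc_one (w v : ue_world) : Prop :=
  exists l, [/\ label l, ue_seq v = rcons (ue_seq w) l
              & prec l (ue_filter w) (ue_filter v)].

Definition ue_acc : ue_world -> ue_world -> Prop := clos_trans _ ue_acc_one.

(* Positions are counted from 0, so position [size (ue_seq w)] holds the first
   label added to the sequence of [w]. *)
Inductive ue_sacc (w : ue_world) : ue_world -> ue_world -> Prop :=
| ue_sacc_refl u : ue_acc w u -> ue_sacc w u u
| ue_sacc_acc u v : ue_acc w u -> ue_acc w v -> ue_acc u v -> ue_sacc w u v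
| ue_sacc_label u v : ue_acc w u -> ue_acc w v ->
    onth (ue_seq u) (size (ue_seq w)) = onth (ue_seq v) (size (ue_seq w)) ->
    ue_sacc w u v
| ue_sacc_trans u v z : ue_sacc w u v -> ue_sacc w v z -> ue_sacc w u z.

Definition ue_frame : iframe := IFrame ue_acc ue_sacc.

Definition ue_val (Atm : Type) (ev : Atm -> set F) : Atm -> set ue_frame :=
  fun p => [set w | ue_filter w (ev p)].

Definition principal_uf (x : F) : set_system F := [set A | A x].

End UltrafilterExtension.

(* Main.v *)
From Stdlib Require Import Relation_Operators.
Require Import Defs.
From mathcomp Require Import all_boot all_classical.

(** By induction on [psi], a world [(f, s)] of the extension forces [psi] iff
    the truth set of [psi] belongs to [f].  The modal cases rest on one
    dichotomy: for a label [l] and a set [B], either [B] belongs to some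
    [prec l]-successor of [f], or [f] contains [rhd_inv B Y], where [Y] is a
    finite union of complements of members of [l].  The step [Box a] uses it
    with the empty label, a counterexample to [Rhd a b] is built from the
    label [{~ b}], and a witness for [Rhd a b] from the first label added on
    the way to the successor to be answered. *)

Set Implicit Arguments.
Unset Strict Implicit.
Unset Printing Implicit Defensive.

Local Open Scope classical_set_scope.

Section InverseImages.
Variable F : iframe.
Implicit Types (A B X Y : set F) (f g l : set_system F).

Lemma rhd_inv_set0 A : rhd_inv (~` A) set0 = box_inv A.
Proof.
apply/seteqP; split=> w hw x.
  by move=> wx; apply: contrapT => /hw /(_ wx) [].
by move=> Ax wx; case: Ax; apply: hw.
Qed.

Lemma rhd_invS X Y Y' : Y `<=` Y' -> rhd_inv X Y `<=` rhd_inv X Y'.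
Proof. by move=> YY' w hw x Xx /(hw x Xx) [y /YY' Yy xy]; exists y. Qed.

(** A point outside the intersection lies outside [A] or outside [B], so one of the two hypotheses
    answers it. This closes the filter built in [prec_extend] under intersection. *)
Lemma rhd_inv_setCI A B X Y :
  rhd_inv (~` A) X `&` rhd_inv (~` B) Y `<=` rhd_inv (~` (A `&` B)) (X `|` Y).
Proof.
move=> w [hA hB] x nABx wx.
have [Ax|/hA/(_ wx) [y Xy xy]] := pselect (A x); last by exists y; [left|].
have [|y Yy xy] := hB x _ wx; first by move=> Bx; apply: nABx.
by exists y; [right|].
Qed.

Hypothesis hF : veltman_frame F.

Lemma rhd_inv_refl X : rhd_inv X X = setT.
Proof.
by apply/seteqP; split=> // w _ x Xx wx; exists x => //; apply: sacc_refl hF _ _ _.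
Qed.

Lemma rhd_inv_trans X Y Z : rhd_inv X Y `&` rhd_inv Y Z `<=` rhd_inv X Z.
Proof.
move=> w [hXY hYZ] x Xx wx; have [y Yy xy] := hXY x Xx wx.
have [_ wy] := sacc_dom hF xy; have [z Zz yz] := hYZ y Yy wy.
by exists z => //; apply: sacc_trans hF _ _ _ _ xy yz.
Qed.

(* A point of [B] outside [A `&` box_inv A] leaves [A] itself or has a
   successor that does; both moves are [sacc] steps. *)
Lemma rhd_inv_box_disjoint A B Y : A `&` box_inv A `&` B `<=` set0 ->
  rhd_inv (~` A) Y `<=` rhd_inv B Y.
Proof.
move=> AB0 w hA x Bx wx.
have [Ax|/hA/(_ wx)//] := pselect (A x).
have /existsNP [z /not_implyP [xz nAz]] : ~ box_inv A x.
  by move=> bAx; apply: (AB0 x).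
have wz := acc_trans hF wx xz.
have [y Yy zy] := hA z nAz wz.
by exists y => //; apply: (sacc_trans hF _ zy); apply: (sacc_acc hF).
Qed.

(** If no such [D] exists, the sets forced upon every [prec l]-successor of [f] are jointly
    consistent with [B], and any ultrafilter extending them serves as [g]. *)
Lemma prec_extend l f B : UltraFilter f ->
  (exists g, [/\ UltraFilter g, prec l f g & g B]) \/
  (exists D, [/\ finite_set D, D `<=` l
               & f (rhd_inv B (\bigcup_(X in D) ~` X))]).
Proof.
move=> uf; have [|noD] := pselect (exists D, [/\ finite_set D, D `<=` l
  & f (rhd_inv B (\bigcup_(X in D) ~` X))]); first by right.
left; pose G : set_system F := [set Z | exists A D, [/\ finite_set D, D `<=` l,
  f (rhd_inv (~` A) (\bigcup_(X in D) ~` X)) & A `&` box_inv A `&` B `<=` Z]].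
have GP : ProperFilter G.
  apply: Build_ProperFilter_ex.
    (* An empty [Z] makes [B] disjoint from the forced sets [A] and [box_inv A], so [D] itself would
       contradict [noD]. *)
    move=> Z [A [D [finD Dl fD ABZ]]]; apply: contrapT => Z0; apply: noD.
    exists D; split=> //; apply: filterS fD; apply: rhd_inv_box_disjoint.
    by move=> z /ABZ Zz; apply: Z0; exists z.
  split.
  - exists setT, set0; split=> //; rewrite bigcup_set0 rhd_inv_set0.
    by apply: filterS filterT => x _ y.
  - move=> Z Z' [A [D [finD Dl fD ABZ]]] [A' [D' [finD' Dl' fD' ABZ']]].
    exists (A `&` A'), (D `|` D'); split.
    + by rewrite finite_setU.
    + by rewrite subUset.
    + rewrite bigcup_setU; apply: filterS (filterI fD fD').
      exact: rhd_inv_setCI.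
    + move=> x [[[Ax A'x] bx] Bx]; split.
        by apply: ABZ; do 2?split=> //; move=> y /bx [].
      by apply: ABZ'; do 2?split=> //; move=> y /bx [].
  - move=> Z Z' ZZ' [A [D [finD Dl fD ABZ]]].
    by exists A, D; split=> //; apply: subset_trans ZZ'.
have [g [ug Gg]] := ultraFilterLemma GP.
exists g; split=> //.
  move=> A D finD Dl fD; split; apply: Gg; exists A, D; split=> //.
    by move=> x [[]].
  by move=> x [[]].
apply: Gg; exists setT, set0; split=> //.
by rewrite bigcup_set0 rhd_inv_set0; apply: filterS filterT => x _ y.
Qed.

End InverseImages.

Section Worlds.
Variable F : iframe.
Implicit Types (w u v : ue_world F) (f g l : set_system F).

Lemma ue_mem_ultra f s : ue_mem f s -> UltraFilter f.
Proof. by case. Qed.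

Lemma ue_filter_ultra w : UltraFilter (ue_filter w).
Proof. exact: ue_mem_ultra (svalP w). Qed.

Lemma prec_box l f g A : prec l f g -> f (box_inv A) -> g A /\ g (box_inv A).
Proof.
by move=> fg fA; apply: (fg A set0) => //; rewrite bigcup_set0 rhd_inv_set0.
Qed.

(** Only the first label survives: what [l] forces at [g] includes [box_inv A], which any further
    step passes on, whatever its label. *)
Lemma prec_trans l l' f g h : prec l f g -> prec l' g h -> prec l f h.
Proof.
by move=> fg gh A D finD Dl /(fg A D finD Dl) [_]; apply: prec_box gh.
Qed.

Lemma ue_acc_prec w u : ue_acc w u -> exists l, [/\ label l,
  exists s, ue_seq u = ue_seq w ++ l :: s & prec l (ue_filter w) (ue_filter u)].
Proof.
elim=> {w u} [w u [l [ll -> wu]]|w v u _ [l [ll [s ->] wv]] _ [l' [_ [s' ->] vu]]].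
  by exists l; split=> //; exists [::]; rewrite cats1.
exists l; split=> //; first by exists (s ++ l' :: s'); rewrite -catA.
exact: prec_trans wv vu.
Qed.

Lemma ue_acc_onth w u : ue_acc w u -> exists l, [/\ label l,
  onth (ue_seq u) (size (ue_seq w)) = Some l
  & prec l (ue_filter w) (ue_filter u)].
Proof.
move=> /ue_acc_prec [l [ll [s ->] wu]]; exists l; split=> //.
by rewrite onth_cat ltnn subnn.
Qed.

(** Each generating clause keeps the label at this position. For a [ue_acc] step, the sequence of
    [v] extends that of [u], which already covers the position. *)
Lemma ue_sacc_onth w u v : ue_sacc w u v -> ue_acc w v /\
  onth (ue_seq u) (size (ue_seq w)) = onth (ue_seq v) (size (ue_seq w)).
Proof.
elim=> {u v} // [u v wu wv uv|u v z _ [_ ->] _ //]; split=> //.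
have [l [_ [s us] _]] := ue_acc_prec wu.
have [l' [_ [s' ->] _]] := ue_acc_prec uv.
by rewrite onth_cat us size_cat -addSnnS leq_addr.
Qed.

Lemma ue_acc_successor w l g : label l -> UltraFilter g ->
  prec l (ue_filter w) g -> exists v, [/\ ue_acc w v, ue_filter v = g
    & ue_seq v = rcons (ue_seq w) l].
Proof.
move=> ll ug wg; have gm := ue_rcons (svalP w) ug ll wg.
exists (exist _ (g, rcons (ue_seq w) l) gm); split=> //.
by apply: t_step; exists l.
Qed.

End Worlds.

(** The empty family intersects to the whole frame, which is nonempty. *)
Lemma label_set0 (F : iframe) : veltman_frame F -> @label F set0.
Proof.
move=> hF; have [x _] := world_nonempty hF; split=> // D D0.
by exists x => A /D0; rewrite inE.
Qed.

Lemma label_set1 (F : iframe) (A : set F) : A !=set0 -> label [set A].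
Proof.
move=> [x Ax]; split; first by move=> _ -> A0; rewrite A0 in Ax.
by move=> D DA; exists x => B /DA; rewrite inE => ->.
Qed.

Lemma ultra_imply (T : Type) (f : set_system T) (A B : set T) :
  UltraFilter f -> (f A -> f B) <-> f [set x | A x -> B x].
Proof.
move=> uf; split=> [fAB|fAB fA]; last by apply: filterS2 fA fAB => x Ax; apply.
have [/fAB|] := in_ultra_setVsetC A uf; first by apply: filterS => x ? ?.
by apply: filterS => x nAx /nAx.
Qed.

Section Truth.
Variables (F : iframe) (hF : veltman_frame F).
Implicit Types (w u v : ue_world F) (A B : set F).

Lemma ue_box w A :
  (forall v, ue_acc w v -> ue_filter v A) <-> ue_filter w (box_inv A).
Proof.
have uw := ue_filter_ultra w; split=> [wA|wA v /ue_acc_prec [l [_ _ wv]]].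
  have [[g [ug wg gA]]|[D [_ D0 wD]]] := prec_extend hF set0 (~` A) uw.
    have [v [/wA vA vg _]] := ue_acc_successor (label_set0 hF) ug wg.
    exfalso; apply: (@filter_not_empty _ g _); rewrite -(setICr A).
    by apply: filterI gA; rewrite -vg.
  (* The label has no members, so [D] is empty and the second alternative says [box_inv A]. *)
  by move: D0 wD; rewrite subset0 => ->; rewrite bigcup_set0 rhd_inv_set0.
by have [] := prec_box wv wA.
Qed.

Lemma ue_rhd w A B :
  (forall u, ue_acc w u -> ue_filter u A ->
     exists v, ue_sacc w u v /\ ue_filter v B) <-> ue_filter w (rhd_inv A B).
Proof.
have uw := ue_filter_ultra w; split=> [wAB|wAB u wu uA]; last first.
  have [l [ll ul wul]] := ue_acc_onth wu.
  have [[g [ug wg gB]]|[D [finD Dl wD]]] := prec_extend hF l B uw.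
    have [v [wv vg vl]] := ue_acc_successor ll ug wg.
    exists v; split; last by rewrite vg.
    by apply: ue_sacc_label => //; rewrite ul vl -cats1 onth_cat ltnn subnn.
  (* Otherwise [wAB] and [wD] compose, and [prec l] puts the complement of [A] into the filter of
     [u], against [uA]. *)
  have uu := ue_filter_ultra u.
  have [unA _] : ue_filter u (~` A) /\ ue_filter u (box_inv (~` A)).
    apply: wul finD Dl _; rewrite setCK; apply: filterS (filterI wAB wD).
    exact: rhd_inv_trans.
  by exfalso; apply: (@filter_not_empty _ (ue_filter u) _); rewrite -(setICr A);
     apply: filterI.
(* The singleton of the complement of [B] is a label only if that complement is nonempty; otherwise
   every point answers itself. *)
have [nB|/set0P/negP/negPn/eqP nB0] := pselect (~` B !=set0); last first.
  rewrite -(setCK B) nB0 setC0; apply: filterS filterT => x _ y Ay xy.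
  by exists y => //; apply: sacc_refl hF _ _ _.
have [[g [ug wg gA]]|[D [finD DB wD]]] := prec_extend hF [set ~` B] A uw.
  have [u [wu ug' ul]] := ue_acc_successor (label_set1 nB) ug wg.
  have [|v [uv vB]] := wAB u wu; first by rewrite ug'.
  (* The shared label forces the complement of [B] at [v] too: the premise of [prec] becomes
     [rhd_inv B B], which is everything. *)
  have [wv] := ue_sacc_onth uv.
  have [l [_ -> wvl]] := ue_acc_onth wv.
  rewrite ul -cats1 onth_cat ltnn subnn => -[lB].
  have uv' := ue_filter_ultra v.
  have [vnB _] : ue_filter v (~` B) /\ ue_filter v (box_inv (~` B)).
    apply: (wvl _ [set ~` B]) => //; first by rewrite lB.
    by rewrite bigcup_set1 rhd_inv_refl//; apply: filterT.
  by exfalso; apply: (@filter_not_empty _ (ue_filter v) _); rewrite -(setICr B);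
     apply: filterI.
apply: filterS wD; apply: rhd_invS => x [X /DB ->].
by rewrite setCK.
Qed.

End Truth.

Lemma ue_truth (Atm : Type) (F : iframe) (hF : veltman_frame F)
    (ev : Atm -> set F) (phi : formula Atm) (w : ue_frame F) :
  forces (ue_val ev) w phi <-> ue_filter w [set x | forces ev x phi].
Proof.
elim: phi w => [p||a IHa b IHb|a IHa|a IHa b IHb] w /=.
- by [].
- have uw := ue_filter_ultra w.
  by split=> // w0; apply: (@filter_not_empty _ (ue_filter w) _).
- by rewrite IHa IHb; apply: (ultra_imply _ _ (ue_filter_ultra w)).
- rewrite -[X in _ <-> X]/(ue_filter w (box_inv [set x | forces ev x a])).
  by rewrite -ue_box//; split=> wa v /wa /IHa.
have -> : [set w : F | forall u, acc w u -> forces ev u a ->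
    exists v, sacc w u v /\ forces ev v b] =
    rhd_inv [set x | forces ev x a] [set x | forces ev x b].
  apply/seteqP; split=> [x xab y ay xy|x xab y xy ay].
    by have [z []] := xab y xy ay; exists z.
  by have [z] := xab y ay xy; exists z.
rewrite -ue_rhd//; split=> wab u wu /IHa /(wab u wu) [v [uv /IHb vb]];
by exists v.
Qed.

Theorem theorem6p4 (Atm : Type) (F : iframe) (hF : veltman_frame F)
    (ev : Atm -> set F) (phi : formula Atm) (x : F)
    (sigma : seq (set_system F)) (h : ue_mem (principal_uf x) sigma) :
  forces ev x phi <->
  @forces Atm (ue_frame F) (ue_val ev) (exist _ (principal_uf x, sigma) h) phi.
(* Membership in [principal_uf x] unfolds to truth at [x]. *)
Proof. by rewrite ue_truth. Qed.
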